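(* Let Assumptions A and B (see context) hold. Let $\{x_k\}_{k\ge 0}$ be a sequence generated by the synchronous inexact proximal best-response scheme (see context) with deterministic inexactness sequences satisfying $\alpha_{i,k}\ge 0$ and $\lim_{k\to\infty}\alpha_{i,k}=0$ for every $i\in\{1,\dots,N\}$. Let $x^*$ be the unique Nash equilibrium of the game. Then: (a) $\lim_{k\to\infty}\mathrm{Var}(x_k)=0$, where $\mathrm{Var}(x_k)=\mathbb E\left[\|\mathbb E[x_k]-x_k\|^2\right]$; (b) $\lim_{k\to\infty}\mathbb E[\|x_{i,k}-x_i^*\|]=0$ for every $i\in\{1,\dots,N\}$.
   Context: Game. There are $N$ players $\mathcal N=\{1,\dots,N\}$. Player $i$ has strategy set $X_i\subseteq\mathbb R^{n_i}$; $X=\prod_i X_i$, $X_{-i}=\prod_{j\ne i}X_j$, $x_{-i}=(x_j)_{j\ne i}$. Let $\xi:\Omega\to\mathbb R^d$ be a random vector on a probability space $(\Omega,\mathcal F,\mathbb P)$. Given $x_{-i}\in X_{-i}$, player $i$ minimizes over $x_i\in X_i$ the function $f_i(x_i,x_{-i})=\mathbb E[\psi_i(x_i,x_{-i};\xi)]$. A Nash equilibrium is a point $x^*\in X$ such that, for every $i$, $x_i^*$ minimizes $f_i(\cdot,x_{-i}^* )$ over $X_i$. $\|\cdot\|$ is the Euclidean norm for vectors and the induced spectral norm for matrices. Assumption A. For every $i$: (a) $X_i$ is closed, compact and convex (nonempty); (b) for every $x_{-i}\in X_{-i}$, $f_i(\cdot,x_{-i})$ is convex and twice continuously differentiable on an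 open set containing $X_i$; moreover $f_i$ is twice differentiable in $x$ on an open set containing $X$; (c) for all $x_{-i}\in X_{-i}$ and all $\omega\in\Omega$, $\psi_i(\cdot,x_{-i};\xi(\omega))$ is differentiable on an open set containing $X_i$, and $\nabla_{x_i}f_i(x_i,x_{-i})=\mathbb E[\nabla_{x_i}\psi_i(x_i,x_{-i};\xi)]$; (d) there is $M_i>0$ with $\mathbb E[\|\nabla_{x_i}\psi_i(x_i,x_{-i};\xi)\|^2]\le M_i^2$ for all $x\in X$. Proximal best-response. Fix $\mu>0$. For $y\in X$, $\hat x_i(y)=\operatorname{argmin}_{x_i\in X_i}\left[f_i(x_i,y_{-i})+\frac{\mu}{2}\|x_i-y_i\|^2\right]$. Matrix $\Gamma$. Let $\zeta_{i,\min}=\inf_{x\in X}\lambda_{\min}(\nabla^2_{x_i}f_i(x))$ and $\zeta_{ij,\max}=\sup_{x\in X}\|\nabla^2_{x_ix_j}f_i(x)\|$ for $j\ne i$, where $\lambda_{\min}(A)$ is the smallest eigenvalue of $(A+A^T)/2$. $\Gamma\in\mathbb R^{N\times N}$ has entries $\Gamma_{ii}=\frac{\mu}{\mu+\zeta_{i,\min}}$ and $\Gamma_{ij}=\frac{\zeta_{ij,\max}}{\mu+\zeta_{i,\min}}$ for $j\neq i$. Assumption B. $\|\Gamma\|<1$. (Under Assumptions A and B the game has a unique Nash equilibrium $x^*$.) Synchronous inexact proximal best-response scheme. Start from $x_{i,0}\in X_i$, $i=1,\dots,N$. Given deterministic sequences $\{\alpha_{i,k}\}_{k\ge0}$, at each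 iteration $k=0,1,2,\dots$ every player $i$ chooses an $X_i$-valued random vector $x_{i,k+1}$ satisfying $\mathbb E[\|x_{i,k+1}-\hat x_i(x_k)\|^2\mid\mathcal F_k]\le\alpha_{i,k}^2$ almost surely, where $x_k=(x_{1,k},\dots,x_{N,k})$ and $\mathcal F_k$ is the $\sigma$-field of the entire information used by the algorithm up to and including the update of $x_k$ (so $\mathcal F_k\subseteq\mathcal F_{k+1}$ and $x_k$ is $\mathcal F_k$-measurable). *)

(* Defs.v *)
From HB Require Import structures.
From mathcomp Require Import all_boot all_order all_algebra.
From mathcomp Require Import all_classical all_reals all_analysis.

Set Implicit Arguments.
Unset Strict Implicit.
Unset Printing Implicit Defensive.
Import Order.TTheory GRing.Theory Num.Theory.
Import numFieldNormedType.Exports.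
Local Open Scope classical_set_scope.
Local Open Scope ring_scope.

(* Vectors are row vectors.  The topology of 'rV_n comes from the sup norm,   *)
(* so the Euclidean norm has to be defined separately.                        *)

Definition enorm (R : realType) (n : nat) (v : 'rV[R]_n) : R :=
  Num.sqrt (\sum_j v 0 j ^+ 2).

(* v *m A^T is the row vector of the matrix-vector product A v^T. *)
Definition opnorm (R : realType) (m n : nat) (A : 'M[R]_(m, n)) : R :=
  sup [set enorm (v *m A^T) | v in [set v : 'rV[R]_n | enorm v <= 1]].

(* For n > 0 the set below is finite and nonempty: its infimum is attained. *)
Definition lambda_min (R : realType) (n : nat) (A : 'M[R]_n) : R :=
  inf [set a | eigenvalue (2^-1 *: (A + A^T)) a].

Definition gradient (R : realType) (n : nat) (g : 'rV[R]_n -> R)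
    (u : 'rV[R]_n) : 'rV[R]_n :=
  \row_a 'D_(delta_mx 0 a) g u.

Definition hessian (R : realType) (n : nat) (g : 'rV[R]_n -> R)
    (u : 'rV[R]_n) : 'M[R]_n :=
  \matrix_(a, b) gradient (fun v => gradient g v 0 a) u 0 b.

Definition twice_differentiable_on (R : realType) (n : nat)
    (U : set 'rV[R]_n) (g : 'rV[R]_n -> R) : Prop :=
  forall u, U u -> differentiable g u /\ differentiable (gradient g) u.

(* Meant for an open U. *)
Definition C2_on (R : realType) (n : nat)
    (U : set 'rV[R]_n) (g : 'rV[R]_n -> R) : Prop :=
  twice_differentiable_on U g /\
  forall u, U u -> {for u, continuous (hessian g)}.

(* A profile x = (x_1, ..., x_N) is a block row vector in R^(n_1 + ... + n_N) *)
(* whose i-th block is submxrow x i; this provides the topology needed for    *)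
(* joint differentiability.                                                   *)
Notation profile R n := ('rV[R]_(\sum_i n i)).

Definition profiles (R : realType) (N : nat) (n : 'I_N -> nat)
    (X : forall i, set 'rV[R]_(n i)) : set (profile R n) :=
  [set x | forall i, X i (submxrow x i)].

(* Encodes the condition y_{-i} \in X_{-i}; block i of y is unconstrained. *)
Definition others_in (R : realType) (N : nat) (n : 'I_N -> nat)
    (X : forall i, set 'rV[R]_(n i)) (i : 'I_N) : set (profile R n) :=
  [set y | forall j, j != i -> X j (submxrow y j)].

(* The profile (u, y_{-i}). *)
Definition replace (R : realType) (N : nat) (n : 'I_N -> nat)
    (y : profile R n) (i : 'I_N) (u : 'rV[R]_(n i)) : profile R n :=
  \mxrow_j dfwith (fun j => submxrow y j) i u j.

Definition block_gradient (R : realType) (N : nat) (n : 'I_N -> nat)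
    (i : 'I_N) (g : profile R n -> R) (x : profile R n) : 'rV[R]_(n i) :=
  gradient (fun u => g (replace x u)) (submxrow x i).

Definition block_hessian (R : realType) (N : nat) (n : 'I_N -> nat)
    (i j : 'I_N) (g : profile R n -> R) (x : profile R n) :
    'M[R]_(n i, n j) :=
  \matrix_(a, b) block_gradient j (fun y => block_gradient i g y 0 a) x 0 b.

Definition argmin_set (R : realType) (T : Type) (A : set T) (g : T -> R) :
    set T :=
  [set u | A u /\ forall v, A v -> g u <= g v].

Definition nash_equilibrium (R : realType) (N : nat) (n : 'I_N -> nat)
    (X : forall i, set 'rV[R]_(n i)) (f : 'I_N -> profile R n -> R)
    (x : profile R n) : Prop :=
  profiles X x /\
  forall i, argmin_set (X i) (fun u => f i (replace x u)) (submxrow x i).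

Definition prox_best_response (R : realType) (N : nat) (n : 'I_N -> nat)
    (X : forall i, set 'rV[R]_(n i)) (f : 'I_N -> profile R n -> R) (mu : R)
    (i : 'I_N) (y : profile R n) : 'rV[R]_(n i) :=
  get (argmin_set (X i)
    (fun u => f i (replace y u) + mu / 2 * enorm (u - submxrow y i) ^+ 2)).

Definition zeta_min (R : realType) (N : nat) (n : 'I_N -> nat)
    (X : forall i, set 'rV[R]_(n i)) (f : 'I_N -> profile R n -> R)
    (i : 'I_N) : R :=
  inf [set lambda_min (block_hessian i i (f i) x) | x in profiles X].

Definition cross_norms (R : realType) (N : nat) (n : 'I_N -> nat)
    (X : forall i, set 'rV[R]_(n i)) (f : 'I_N -> profile R n -> R)
    (i j : 'I_N) : set R :=
  [set opnorm (block_hessian i j (f i) x) | x in profiles X].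

Definition zeta_max (R : realType) (N : nat) (n : 'I_N -> nat)
    (X : forall i, set 'rV[R]_(n i)) (f : 'I_N -> profile R n -> R)
    (i j : 'I_N) : R :=
  sup (cross_norms X f i j).

Definition Gamma (R : realType) (N : nat) (n : 'I_N -> nat)
    (X : forall i, set 'rV[R]_(n i)) (f : 'I_N -> profile R n -> R) (mu : R) :
    'M[R]_N :=
  \matrix_(i, j) ((if i == j then mu else zeta_max X f i j) /
                  (mu + zeta_min X f i)).

(* The real-valued sup of an unbounded set is 0, so finiteness of the suprema *)
(* defining the off-diagonal entries has to be stated explicitly.             *)
Definition contractive_game (R : realType) (N : nat) (n : 'I_N -> nat)
    (X : forall i, set 'rV[R]_(n i)) (f : 'I_N -> profile R n -> R) (mu : R) :
    Prop :=
  (forall i j, j != i -> has_ubound (cross_norms X f i j)) /\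
  opnorm (Gamma X f mu) < 1.

Section Randomness.
Context {d : measure_display} {T : measurableType d} {R : realType}.
Variable P : probability T R.

Definition real_integrable (Z : T -> R) : Prop :=
  P.-integrable [set: T] (EFin \o Z).

Definition random_vector (m : nat) (xi : T -> 'rV[R]_m) : Prop :=
  forall j, measurable_fun [set: T] (fun w => xi w 0 j).

Definition sub_sigma_algebra_of_space (G : set (set T)) : Prop :=
  sigma_algebra [set: T] G /\ G `<=` measurable.

Definition measurable_wrt (G : set (set T)) (Z : T -> R) : Prop :=
  forall B : set R, measurable B -> G (Z @^-1` B).

(* Y is a version of the conditional expectation E[Z | G]. *)
Definition is_cond_expectation (G : set (set T)) (Z Y : T -> R) : Prop :=
  [/\ real_integrable Z, real_integrable Y, measurable_wrt G Y &
      forall A, G A ->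
        (\int[P]_(w in A) (Y w)%:E = \int[P]_(w in A) (Z w)%:E)%E].

Definition mean (m : nat) (z : T -> 'rV[R]_m) : 'rV[R]_m :=
  \row_j fine 'E_P[fun w => (z w 0 j)%R]%E.

Definition total_variance (m : nat) (z : T -> 'rV[R]_m) : \bar R :=
  'E_P[fun w => (enorm (mean z - z w) ^+ 2)%R]%E.

Definition cost (N : nat) (n : 'I_N -> nat) (m : nat) (xi : T -> 'rV[R]_m)
    (psi : 'I_N -> profile R n -> 'rV[R]_m -> R) (i : 'I_N)
    (x : profile R n) : R :=
  fine 'E_P[fun w => (psi i x (xi w))%R]%E.

(* cost is a real-valued expectation only where psi_i(x; xi) is integrable;   *)
(* this is required on the open sets on which cost is differentiated.         *)
Record regular_game (N : nat) (n : 'I_N -> nat)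
    (X : forall i, set 'rV[R]_(n i)) (m : nat) (xi : T -> 'rV[R]_m)
    (psi : 'I_N -> profile R n -> 'rV[R]_m -> R) (i : 'I_N) : Prop := {
  strategies_nonempty : X i !=set0 ;
  strategies_closed : closed (X i) ;
  strategies_compact : compact (X i) ;
  strategies_convex : convex_set (X i : set (convex_lmodType 'rV[R]_(n i))) ;
  cost_convex_C2 : forall y, others_in X i y ->
    exists U : set 'rV[R]_(n i),
      [/\ open U, X i `<=` U,
          convex_set (U : set (convex_lmodType 'rV[R]_(n i))),
          (forall u, U u ->
             real_integrable (fun w => psi i (replace y u) (xi w))) &
          convex_function U (fun u => cost xi psi i (replace y u)) /\
          C2_on U (fun u => cost xi psi i (replace y u))] ;
  cost_twice_differentiable : exists W : set (profile R n),
    [/\ open W, profiles X `<=` W,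
        (forall x, W x -> real_integrable (fun w => psi i x (xi w))) &
        twice_differentiable_on W (cost xi psi i)] ;
  sample_differentiable : forall y w, others_in X i y ->
    exists V : set 'rV[R]_(n i),
      [/\ open V, X i `<=` V &
          forall u, V u -> differentiable (fun v => psi i (replace y v) (xi w)) u] ;
  gradient_unbiased : forall x, profiles X x -> forall a,
    real_integrable (fun w => block_gradient i (psi i ^~ (xi w)) x 0 a) /\
    (block_gradient i (cost xi psi i) x 0 a)%:E =
      'E_P[fun w => (block_gradient i (psi i ^~ (xi w)) x 0 a)%R]%E ;
  gradient_second_moment : exists M : R, 0 < M /\
    forall x, profiles X x ->
      ('E_P[fun w => (enorm (block_gradient i (psi i ^~ (xi w)) x) ^+ 2)%R]
         <= (M ^+ 2)%:E)%E
}.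

(* F is the filtration of the information available to the algorithm; the     *)
(* starting profile may be random as long as it is F_0-measurable, which      *)
(* covers deterministic starting points.                                      *)
Record inexact_prox_scheme (N : nat) (n : 'I_N -> nat)
    (X : forall i, set 'rV[R]_(n i)) (f : 'I_N -> profile R n -> R) (mu : R)
    (alpha : 'I_N -> nat -> R) (F : nat -> set (set T))
    (x : nat -> T -> profile R n) : Prop := {
  scheme_sigma_algebra : forall k, sub_sigma_algebra_of_space (F k) ;
  scheme_filtration : forall k, F k `<=` F k.+1 ;
  scheme_adapted : forall k j, measurable_wrt (F k) (fun w => x k w 0 j) ;
  scheme_feasible : forall k w, profiles X (x k w) ;
  scheme_update : forall k i, exists Y : T -> R,
    is_cond_expectation (F k)
      (fun w => enorm (submxrow (x k.+1 w) i -
                       prox_best_response X f mu i (x k w)) ^+ 2) Y /\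
    {ae P, forall w, Y w <= alpha i k ^+ 2}
}.

End Randomness.

(* Main.v *)
Require Import Defs.
From mathcomp Require Import all_boot all_order all_algebra.
From mathcomp Require Import all_classical all_reals all_analysis.
From mathcomp Require Import measurable_realfun ring lra.
Import Order.TTheory GRing.Theory Num.Theory.
Import numFieldNormedType.Exports.
Local Open Scope classical_set_scope.
Local Open Scope ring_scope.

(** Write [D_i^k = |x_{i,k} - x_i^*|].  The first-order conditions of the two
    proximal problems defining [xhat_i y] and [xhat_i z], combined with the mean
    value theorem for [grad_i f_i] on the segment from [(xhat_i y, y_{-i})] to
    [(xhat_i z, z_{-i})], give
      [|xhat_i z - xhat_i y| <= sum_j Gamma_ij |z_j - y_j|],
    and [xhat x^* = x^*].  Hence, pathwise,
      [D_i^(k+1) <= |x_{i,k+1} - xhat_i x_k| + sum_j Gamma_ij D_j^k].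
    Taking expectations, the vector [E D^k] satisfies a linear recursion with
    the contraction [Gamma] and a perturbation [alpha_k] tending to [0], which
    gives (b).  Since the strategy sets are bounded, [Var x_k] is controlled by
    the first moments [E D_i^k], which gives (a). *)

(** * Euclidean norm and operator norm *)

Definition dot {R : realType} {n : nat} (u v : 'rV[R]_n) : R :=
  \sum_j u 0 j * v 0 j.

Lemma enorm_ge0 {R : realType} {n : nat} (v : 'rV[R]_n) : 0 <= enorm v.
Proof. exact: sqrtr_ge0. Qed.

Lemma sqr_enorm {R : realType} {n : nat} (v : 'rV[R]_n) :
  enorm v ^+ 2 = dot v v.
Proof.
rewrite sqr_sqrtr; first by apply: eq_bigr => j _; rewrite expr2.
by apply: sumr_ge0 => j _; rewrite sqr_ge0.
Qed.

Lemma dotC {R : realType} {n : nat} (u v : 'rV[R]_n) : dot u v = dot v u.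
Proof. by apply: eq_bigr => j _; rewrite mulrC. Qed.

Lemma dotDr {R : realType} {n : nat} (u v w : 'rV[R]_n) :
  dot u (v + w) = dot u v + dot u w.
Proof. by rewrite -big_split; apply: eq_bigr => j _; rewrite mxE mulrDr. Qed.

Lemma dotZr {R : realType} {n : nat} (a : R) (u v : 'rV[R]_n) :
  dot u (a *: v) = a * dot u v.
Proof. by rewrite mulr_sumr; apply: eq_bigr => j _; rewrite mxE mulrCA. Qed.

Lemma dotDl {R : realType} {n : nat} (u v w : 'rV[R]_n) :
  dot (v + w) u = dot v u + dot w u.
Proof. by rewrite !(dotC _ u) dotDr. Qed.

Lemma dotZl {R : realType} {n : nat} (a : R) (u v : 'rV[R]_n) :
  dot (a *: u) v = a * dot u v.
Proof. by rewrite !(dotC _ v) dotZr. Qed.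

Lemma dotNr {R : realType} {n : nat} (u v : 'rV[R]_n) : dot u (- v) = - dot u v.
Proof. by rewrite -scaleN1r dotZr mulN1r. Qed.

Lemma dotNl {R : realType} {n : nat} (u v : 'rV[R]_n) : dot (- u) v = - dot u v.
Proof. by rewrite !(dotC _ v) dotNr. Qed.

Lemma dot_ge0 {R : realType} {n : nat} (u : 'rV[R]_n) : 0 <= dot u u.
Proof. by rewrite -sqr_enorm sqr_ge0. Qed.

Lemma dot_eq0 {R : realType} {n : nat} (u : 'rV[R]_n) : dot u u = 0 -> u = 0.
Proof.
move=> /psumr_eq0P u0; apply/rowP => j; rewrite mxE.
by apply/eqP; rewrite -sqrf_eq0 expr2 u0// => k _; rewrite -expr2 sqr_ge0.
Qed.

Lemma enorm_eq0 {R : realType} {n : nat} (u : 'rV[R]_n) : enorm u = 0 -> u = 0.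
Proof. by move=> u0; apply: dot_eq0; rewrite -sqr_enorm u0 expr0n. Qed.

Lemma enorm0 {R : realType} {n : nat} : enorm (0 : 'rV[R]_n) = 0.
Proof. by apply/eqP; rewrite -sqrf_eq0 sqr_enorm -(scale0r 0) dotZl mul0r. Qed.

Lemma enormN {R : realType} {n : nat} (u : 'rV[R]_n) : enorm (- u) = enorm u.
Proof. by congr Num.sqrt; apply: eq_bigr => j _; rewrite mxE sqrrN. Qed.

Lemma enormZ {R : realType} {n : nat} (a : R) (u : 'rV[R]_n) :
  enorm (a *: u) = `|a| * enorm u.
Proof.
apply/eqP; rewrite -(@eqrXn2 _ 2)// ?mulr_ge0 ?enorm_ge0//.
by rewrite exprMn !sqr_enorm dotZl dotZr mulrA real_normK ?num_real// expr2.
Qed.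

Lemma cauchy_schwarz {R : realType} {n : nat} (u v : 'rV[R]_n) :
  dot u v <= enorm u * enorm v.
Proof.
have [/eqP/enorm_eq0->|u0] := boolP (enorm u == 0).
  by rewrite -(scale0r 0) dotZl mul0r mulr_ge0 ?enorm_ge0.
have [/eqP/enorm_eq0->|v0] := boolP (enorm v == 0).
  by rewrite -(scale0r 0) dotZr mul0r mulr_ge0 ?enorm_ge0.
(* This square expands to [2 |u| |v| (|u| |v| - dot u v)], and the positive factor [|u| |v|]
   cancels. *)
have := dot_ge0 (enorm v *: u - enorm u *: v).
rewrite !(dotDr, dotDl, dotNr, dotNl, dotZr, dotZl) (dotC v u) -!sqr_enorm.
have uv0 : 0 < enorm u * enorm v by rewrite mulr_gt0 // lt0r ?u0 ?v0 enorm_ge0.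
by move=> H; rewrite -(ler_pM2l uv0); lra.
Qed.

Lemma enormD {R : realType} {n : nat} (u v : 'rV[R]_n) :
  enorm (u + v) <= enorm u + enorm v.
Proof.
rewrite -(@ler_pXn2r _ 2)// ?nnegrE ?addr_ge0 ?enorm_ge0//.
rewrite sqrrD !sqr_enorm dotDl !dotDr (dotC v u).
have := cauchy_schwarz u v; lra.
Qed.

Lemma ler_enorm {R : realType} {n : nat} (u v : 'rV[R]_n) :
  (forall j, 0 <= u 0 j <= v 0 j) -> enorm u <= enorm v.
Proof.
move=> uv; rewrite ler_sqrt; last by apply: sumr_ge0 => j _; rewrite sqr_ge0.
apply: ler_sum => j _; have /andP[u0 uvj] := uv j.
by rewrite ler_pXn2r ?nnegrE // (le_trans u0).
Qed.

Lemma ler_coord_enorm {R : realType} {n : nat} (u : 'rV[R]_n) j :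
  `|u 0 j| <= enorm u.
Proof.
rewrite -(@ler_pXn2r _ 2)// ?nnegrE ?enorm_ge0// sqr_enorm /dot (bigD1 j)//=.
rewrite real_normK ?num_real// expr2 lerDl.
by apply: sumr_ge0 => k _; rewrite -expr2 sqr_ge0.
Qed.

Lemma ler_enorm_sum {R : realType} {n : nat} (u : 'rV[R]_n) :
  enorm u <= \sum_j `|u 0 j|.
Proof.
rewrite -(@ler_pXn2r _ 2)// ?nnegrE ?enorm_ge0 ?sumr_ge0//.
rewrite sqr_enorm /dot expr2 mulr_suml; apply: ler_sum => j _.
rewrite -expr2 -real_normK ?num_real// expr2 ler_wpM2l// (bigD1 j)//=.
by rewrite lerDl sumr_ge0.
Qed.

Lemma ler_opnorm {R : realType} {m n : nat} (A : 'M[R]_(m, n)) (v : 'rV[R]_n) :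
  enorm (v *m A^T) <= opnorm A * enorm v.
Proof.
have [/eqP/enorm_eq0->|v0] := boolP (enorm v == 0).
  by rewrite mul0mx !enorm0 mulr0.
have v_gt0 : 0 < enorm v by rewrite lt0r v0 enorm_ge0.
rewrite -ler_pdivrMr// mulrC -[X in X * _](ger0_norm)// ?invr_ge0 ?enorm_ge0//.
rewrite -enormZ scalemxAl; apply: ub_le_sup; last first.
  exists ((enorm v)^-1 *: v) => //=.
  by rewrite enormZ ger0_norm ?invr_ge0 ?enorm_ge0// mulVf.
(* The supremum is meaningful only for a bounded set. On the unit ball every coordinate of [u] is at
   most 1 in absolute value, so the sum of all [|A j k|] is an upper bound. *)
exists (\sum_j \sum_k `|A j k|) => _ [u /= u1 <-].
apply: (le_trans (ler_enorm_sum _)); apply: ler_sum => j _.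
rewrite mxE; apply: (le_trans (ler_norm_sum _ _ _)); apply: ler_sum => k _.
by rewrite mxE normrM ler_piMl// (le_trans (ler_coord_enorm _ _)).
Qed.

(** When [E] is empty or unbounded above, [sup E] takes its default value 0, so no boundedness is
    asked for. *)
Lemma sup_ge0 {R : realType} (E : set R) :
  (forall a, E a -> 0 <= a) -> 0 <= sup E.
Proof.
move=> E0; have [sE|nE] := pselect (has_sup E); last by rewrite sup_out.
by have [[a Ea] _] := sE; rewrite (le_trans (E0 _ Ea))// (sup_upper_bound sE).
Qed.

Lemma opnorm_ge0 {R : realType} {m n : nat} (A : 'M[R]_(m, n)) : 0 <= opnorm A.
Proof.
by apply: sup_ge0 => _ [v _ <-]; exact: enorm_ge0.
Qed.

Lemma continuous_dot {R : realType} {n : nat} (T : topologicalType)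
    (f g : T -> 'rV[R]_n) :
  continuous f -> continuous g -> continuous (fun t => dot (f t) (g t)).
Proof.
move=> cf cg t; apply: cvg_big => [|j _]; first exact: add_continuous.
have coord (h : T -> 'rV[R]_n) : continuous h -> h s 0 j @[s --> t] --> h t 0 j.
  by move=> ch; exact: (cvg_comp _ _ (ch t) (@coord_continuous R 1 n 0 j (h t))).
by apply: cvgM; exact: coord.
Qed.

Lemma enorm_continuous {R : realType} {n : nat} : continuous (@enorm R n).
Proof.
have -> : @enorm R n = fun v => Num.sqrt (dot v v).
  by apply/funext => v; rewrite -sqr_enorm sqrtr_sqr ger0_norm// enorm_ge0.
have cid : continuous (@id 'rV[R]_n) by move=> u; exact: cvg_id.
have c := continuous_dot _ _ _ cid cid.
by move=> v; exact: (cvg_comp _ _ (c v) (@sqrt_continuous R _)).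
Qed.

Lemma continuous_sqr_enormB {R : realType} {n : nat} (c : 'rV[R]_n) :
  continuous (fun v : 'rV[R]_n => enorm (v - c) ^+ 2).
Proof.
have cB : continuous (fun v : 'rV[R]_n => v - c).
  by move=> v; exact: (cvgB cvg_id (cvg_cst c)).
have -> : (fun v => enorm (v - c) ^+ 2) = fun v => dot (v - c) (v - c).
  by apply/funext => v; rewrite sqr_enorm.
exact: continuous_dot.
Qed.

(** * Smallest eigenvalue *)

(** The left-hand norm is the sup norm, in which [bounded_set] is expressed; Euclidean bounds
    thereby give boundedness and, with closedness, compactness. *)
Lemma ler_norm_enorm {R : realType} {n : nat} (v : 'rV[R]_n) : `|v| <= enorm v.
Proof.
rewrite /Num.norm /= mx_normrE; apply: bigmax_le => [|[i j] _].
  exact: enorm_ge0.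
by rewrite (ord1 i) ler_coord_enorm.
Qed.

Lemma enorm_bounded_set {R : realType} {n : nat} (r : R) (A : set 'rV[R]_n) :
  (forall v, A v -> enorm v <= r) -> bounded_set A.
Proof.
move=> Ar; exists r; split; first exact: num_real.
move=> M rM v /= /Ar vr.
exact: (le_trans (ler_norm_enorm v) (le_trans vr (ltW rM))).
Qed.

Lemma unit_sphere_compact {R : realType} {n : nat} :
  compact [set v : 'rV[R]_n | enorm v = 1].
Proof.
apply: bounded_closed_compact.
  by apply: (enorm_bounded_set 1) => v /= ->.
apply: (@preimage_closed _ _ (@enorm R n) [set a | a = 1]).
  by move=> v _; exact: enorm_continuous.
exact: closed_eq.
Qed.

Definition quad {R : realType} {n : nat} (S : 'M[R]_n) (v : 'rV[R]_n) : R :=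
  dot v (v *m S).

Lemma quad_continuous {R : realType} {n : nat} (S : 'M[R]_n) :
  continuous (quad S).
Proof.
have coord j := @coord_continuous R 1 n 0 j.
have cM (f g : 'rV[R]_n -> R) :
    continuous f -> continuous g -> continuous (fun v => f v * g v).
  by move=> cf cg v; exact: (cvgM (cf v) (cg v)).
have cS : continuous (fun v : 'rV[R]_n => \sum_j v 0 j * \sum_k v 0 k * S k j).
  apply: continuous_big => [|j _]; first exact: add_continuous.
  apply: (cM _ _); first exact: coord.
  apply: continuous_big => [|k _]; first exact: add_continuous.
  by apply: (cM _ _); [exact: coord|exact: cst_continuous].
suff -> : quad S = fun v => \sum_j v 0 j * \sum_k v 0 k * S k j by [].
by apply/funext => v; apply: eq_bigr => j _; rewrite mxE.
Qed.

Lemma dot_mulmx {R : realType} {m n : nat} (S : 'M[R]_(m, n)) u v :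
  dot u (v *m S) = dot (u *m S^T) v.
Proof.
rewrite /dot; under eq_bigr => j _ do rewrite mxE mulr_sumr.
rewrite exchange_big /=; apply: eq_bigr => k _; rewrite mxE mulr_suml.
by apply: eq_bigr => j _; rewrite mxE mulrCA mulrC mulrAC.
Qed.

(** With [w = v S], symmetry gives [quad S (v - t w) = -2 t |w|^2 + t^2 quad S w], which is negative
    for small [t > 0] unless [w = 0]. *)
Lemma psd_kernel {R : realType} {n : nat} (S : 'M[R]_n) (v : 'rV[R]_n) :
  S^T = S -> (forall u, 0 <= quad S u) -> quad S v = 0 -> v *m S = 0.
Proof.
move=> symS S0 Sv0; apply: dot_eq0; set w := v *m S.
have [//|/eqP ww0] := pselect (dot w w = 0).
have ww : 0 < dot w w by rewrite lt0r ww0 dot_ge0.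
have Q t : 0 <= - (t * dot w w) *+ 2 + t ^+ 2 * quad S w.
  have := S0 (v - t *: w); rewrite /quad mulmxBl -scalemxAl.
  rewrite !(dotDr, dotDl, dotNr, dotNl, dotZr, dotZl).
  rewrite [dot v (w *m S)]dot_mulmx symS -/w -/(quad S v) Sv0 -/(quad S w).
  by lra.
(* This [t = a / (b + a)] is small enough to make the quadratic negative, and its denominator is
   positive even when [b = quad S w] vanishes. *)
have := S0 w; have := Q (dot w w / (quad S w + dot w w)).
set a := dot w w in ww *; set b := quad S w => + b0.
have ab0 : 0 < b + a by lra.
have -> : - (a / (b + a) * a) *+ 2 + (a / (b + a)) ^+ 2 * b =
  - (a ^+ 2 * (b + a *+ 2)) / (b + a) ^+ 2 by field; rewrite gt_eqF.
rewrite mulNr oppr_ge0 => H.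
have : 0 < a ^+ 2 * (b + a *+ 2) / (b + a) ^+ 2.
  by rewrite divr_gt0 ?exprn_gt0// mulr_gt0 ?exprn_gt0//; lra.
lra.
Qed.

Section SmallestEigenvalue.
Context {R : realType} {n : nat} (n_gt0 : (0 < n)%N).

Lemma unit_sphere_nonempty : [set v : 'rV[R]_n | enorm v = 1] !=set0.
Proof.
exists (delta_mx 0 (Ordinal n_gt0)); rewrite /= /enorm (bigD1 (Ordinal n_gt0))//=.
rewrite big1 => [|j j0]; last by rewrite mxE (negbTE j0) expr0n.
by rewrite mxE !eqxx expr1n addr0 sqrtr1.
Qed.

Lemma ler_quad (S : 'M[R]_n) a :
  (forall v, enorm v = 1 -> a <= quad S v) ->
  forall v, a * enorm v ^+ 2 <= quad S v.
Proof.
move=> H v; have [/eqP/enorm_eq0->|v0] := boolP (enorm v == 0).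
  by rewrite enorm0 expr0n mulr0 /quad mul0mx dot_ge0.
have v_gt0 : 0 < enorm v by rewrite lt0r v0 enorm_ge0.
have := H ((enorm v)^-1 *: v).
rewrite enormZ ger0_norm ?invr_ge0 ?enorm_ge0// mulVf// => /(_ erefl).
rewrite /quad -scalemxAl dotZl dotZr mulrA -expr2 exprVn => h.
by rewrite -ler_pdivlMr ?exprn_gt0// mulrC.
Qed.

(* The minimum of the quadratic form on the unit sphere is attained at an
   eigenvector. *)
Lemma symmetric_min_eigen (S : 'M[R]_n) : S^T = S ->
  exists2 a, eigenvalue S a & forall v, a * enorm v ^+ 2 <= quad S v.
Proof.
move=> symS.
have [v0 /set_mem /= v01 v0min] := compact_EVT_min unit_sphere_nonempty
  unit_sphere_compact (continuous_subspaceT (@quad_continuous R n S)).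
set a := quad S v0 in v0min.
have aP : forall v, a * enorm v ^+ 2 <= quad S v.
  by apply: ler_quad => v v1; apply: v0min; rewrite inE.
exists a => //; apply/eigenvalueP; exists v0; last first.
  by apply/negP => /eqP v00; move: v01; rewrite v00 enorm0; lra.
(* The shifted matrix [S - a I] is positive semidefinite and its form vanishes at the minimizer
   [v0], so [psd_kernel] puts [v0] in its kernel. *)
have quadB u : quad (S - a%:M) u = quad S u - a * enorm u ^+ 2.
  by rewrite /quad mulmxBr dotDr dotNr mul_mx_scalar dotZr sqr_enorm.
apply/eqP; rewrite -subr_eq0 -mul_mx_scalar -mulmxBr; apply/eqP.
apply: psd_kernel.
- by rewrite linearB /= symS tr_scalar_mx.
- by move=> u; rewrite quadB subr_ge0.
- by rewrite quadB v01 expr1n mulr1 subrr.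
Qed.

Lemma quad_sym (A : 'M[R]_n) v :
  quad (2^-1 *: (A + A^T)) v = quad A v.
Proof.
rewrite /quad -scalemxAr mulmxDr dotZr dotDr [in X in _ + X]dot_mulmx trmxK.
by rewrite [in X in _ + X]dotC; lra.
Qed.

Lemma lambda_minP (A : 'M[R]_n) v : lambda_min A * enorm v ^+ 2 <= quad A v.
Proof.
have symS : (2^-1 *: (A + A^T))^T = 2^-1 *: (A + A^T).
  by rewrite linearZ linearD /= trmxK addrC.
have [a eiga aP] := symmetric_min_eigen _ symS.
rewrite -quad_sym; apply: le_trans (aP v); apply: ler_wpM2r.
  exact: sqr_ge0.
(* The infimum is at most its member [a] provided the eigenvalues are bounded below. The bound is
   [a] itself: at an eigenvector [u] for [e], [a |u|^2 <= quad u = e |u|^2]. *)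
apply: ge_inf => //; exists a => e /= /eigenvalueP[u ue u0].
have /negP/negP ue0 : enorm u != 0 by apply: contra u0 => /eqP/enorm_eq0->.
have := aP u; rewrite /quad ue dotZr -sqr_enorm ler_pM2r//.
by rewrite exprn_gt0// lt0r ue0 enorm_ge0.
Qed.

Lemma lambda_min_ge0 (A : 'M[R]_n) :
  (forall v, 0 <= quad A v) -> 0 <= lambda_min A.
Proof.
move=> A0; have symS : (2^-1 *: (A + A^T))^T = 2^-1 *: (A + A^T).
  by rewrite linearZ linearD /= trmxK addrC.
have [a eiga _] := symmetric_min_eigen _ symS.
apply: lb_le_inf; first by exists a.
move=> e /= /eigenvalueP[u ue u0].
have := A0 u; rewrite -quad_sym /quad ue dotZr -sqr_enorm pmulr_lge0//.
by rewrite exprn_gt0// lt0r enorm_ge0 andbT; apply: contra u0 => /eqP/enorm_eq0->.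
Qed.

End SmallestEigenvalue.

(** * Block replacement and directional derivatives *)

Section Replace.
Context {R : realType} {N : nat} {n : 'I_N -> nat}.
Implicit Types (x y : profile R n) (i j : 'I_N).

Lemma submxrow_replace y i (u : 'rV[R]_(n i)) :
  submxrow (replace y u) i = u.
Proof. by rewrite /replace mxrowK dfwithin. Qed.

Lemma submxrow_replace_neq y i (u : 'rV[R]_(n i)) j :
  j != i -> submxrow (replace y u) j = submxrow y j.
Proof. by move=> ji; rewrite /replace mxrowK dfwithout // eq_sym. Qed.

Lemma replace_self y i : replace y (submxrow y i) = y.
Proof.
apply/mxrowP => j; have [->|ji] := eqVneq j i; first exact: submxrow_replace.
exact: submxrow_replace_neq.
Qed.

Lemma replaceD x y i (u v : 'rV[R]_(n i)) :
  replace (x + y) (u + v) = replace x u + replace y v.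
Proof.
apply/mxrowP => j; rewrite submxrowD; have [->|ji] := eqVneq j i.
  by rewrite !submxrow_replace.
by rewrite !submxrow_replace_neq// submxrowD.
Qed.

Lemma submxrowZ (a : R) x j : submxrow (a *: x) j = a *: submxrow x j.
Proof. by apply/matrixP => k l; rewrite !mxE. Qed.

Lemma replaceZ (a : R) i (u : 'rV[R]_(n i)) :
  replace 0 (a *: u) = a *: replace 0 u :> profile R n.
Proof.
apply/mxrowP => j; rewrite submxrowZ; have [->|ji] := eqVneq j i.
  by rewrite !submxrow_replace.
by rewrite !submxrow_replace_neq// submxrow0 scaler0.
Qed.

(** A line in block [i] becomes a line in profile space with direction [replace 0 u]; this turns
    block derivatives into directional derivatives on profiles. *)
Lemma replaceDZ y i (a : R) (u v : 'rV[R]_(n i)) :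
  replace y (a *: u + v) = a *: replace 0 u + replace y v.
Proof. by rewrite -replaceZ -replaceD add0r. Qed.

Lemma replace_sum x : x = \sum_i replace 0 (submxrow x i).
Proof.
apply/mxrowP => j; rewrite submxrow_sum (bigD1 j)//= submxrow_replace.
rewrite big1 ?addr0// => i ij.
by rewrite submxrow_replace_neq 1?eq_sym// submxrow0.
Qed.

Lemma replace_delta i (a : 'I_(n i)) :
  replace 0 (delta_mx 0 a) = delta_mx 0 (tagnat.Rank i a) :> profile R n.
Proof.
have RankE j (b : 'I_(n j)) :
    (tagnat.Rank j b == tagnat.Rank i a) = (j == i) && (b == a :> nat).
  exact: tagnat.eq_Rank.
apply/mxrowP => j; have [->|ji] := eqVneq j i.
  by rewrite submxrow_replace; apply/rowP => b; rewrite !mxE !eqxx RankE eqxx.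
rewrite submxrow_replace_neq// submxrow0; apply/rowP => b.
by rewrite !mxE eqxx RankE (negbTE ji).
Qed.

End Replace.

(** * Directional derivatives along lines *)

Section Lines.
Context {R : realType}.

(** A directional derivative sees only the restriction to a line, so it can be transferred between a
    block, a profile and the real parameter of a segment. *)
Lemma derivative_line (V V' W : normedModType R) (f : V -> W) (g : V' -> W)
    a v a' v' :
  (forall h : R, f (h *: v + a) = g (h *: v' + a')) ->
  (derivable f a v <-> derivable g a' v') /\ 'D_v f a = 'D_v' g a'.
Proof.
move=> fg; rewrite /derivable /derive.
suff -> : (fun h : R => h^-1 *: ((f \o shift a) (h *: v) - f a)) =
          (fun h : R => h^-1 *: ((g \o shift a') (h *: v') - g a')) by [].
apply/funext => h /=; rewrite fg; congr (_ *: (_ - _)).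
by have := fg 0; rewrite !scale0r !add0r.
Qed.

(* The quadratic error term [K] absorbs the proximal term of the objective. *)
Lemma derive_ge_near (V : normedModType R) (f : V -> R) a v c K :
  derivable f a v ->
  (\forall h \near 0^'+, h * c - h ^+ 2 * K <= f (h *: v + a) - f a) ->
  c <= 'D_v f a.
Proof.
move=> df fc.
have dR : (h^-1 *: ((f \o shift a) (h *: v) - f a)) @[h --> 0^'+] --> 'D_v f a.
  move=> A /df [e /= egt0 Ae]; exists e => // x xe xgt0; apply: Ae => //.
  exact/lt0r_neq0.
have cK : (c - h * K) @[h --> 0^'+] --> c.
  rewrite -[X in _ --> X]subr0 -[X in _ --> _ - X](mul0r K).
  apply: cvgB; first exact: cvg_cst.
  by apply: cvgM; [exact: cvg_at_right_filter cvg_id|exact: cvg_cst].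
apply: (ler_cvg_to cK dR).
near=> h; have h0 : 0 < h by [].
rewrite -(ler_pM2l h0) /= -[_ *: (f _ - _)]/(_ * _) [leRHS]mulrA.
rewrite mulfV ?gt_eqF// mul1r.
have -> : h * (c - h * K) = h * c - h ^+ 2 * K by ring.
by near: h.
Unshelve. all: by end_near. Qed.

Lemma derive_le_near (V : normedModType R) (f : V -> R) a v c :
  derivable f a v ->
  (\forall h \near 0^'+, f (h *: v + a) - f a <= h * c) ->
  'D_v f a <= c.
Proof.
move=> df fc; rewrite -lerN2 -deriveN//.
apply: (derive_ge_near _ _ _ _ _ 0); first exact: derivableN.
near=> h; rewrite mulr0 subr0 mulrN /=.
have : f (h *: v + a) - f a <= h * c by near: h.
have oppE u : (- f) u = - f u by [].
by rewrite !oppE; lra.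
Unshelve. all: by end_near. Qed.

End Lines.

(** * Gradient and Hessian blocks *)

Section BlockDerivatives.
Context {R : realType} {N : nat} {n : 'I_N -> nat}.
Implicit Types (x y w : profile R n) (i j : 'I_N) (g : profile R n -> R).

Lemma block_gradientE i g y : block_gradient i g y = submxrow (gradient g y) i.
Proof.
apply/rowP => a; rewrite !mxE.
apply: (derivative_line _ _ _ _ _ _ _ _ _ _).2 => h.
by rewrite replaceDZ replace_delta replace_self.
Qed.

Lemma block_hessianE i j g x a b : block_hessian i j g x a b =
  'D_(delta_mx 0 (tagnat.Rank j b)) (fun y => gradient g y 0 (tagnat.Rank i a)) x.
Proof.
rewrite mxE block_gradientE !mxE; congr derive.
by apply/funext => y; rewrite block_gradientE mxE.
Qed.

Lemma derive_replace (G : profile R n -> R) x i (u : 'rV[R]_(n i)) :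
  differentiable G x ->
  'D_(replace 0 u) G x = \sum_b u 0 b * 'D_(delta_mx 0 (tagnat.Rank i b)) G x.
Proof.
move=> dG; have -> : replace 0 u =
    \sum_b u 0 b *: delta_mx 0 (tagnat.Rank i b) :> profile R n.
  have rD : {morph @replace R N n 0 i : v w / v + w}.
    by move=> v w; rewrite -replaceD addr0.
  have r0 : @replace R N n 0 i 0 = 0.
    by have := @replaceZ R N n 0 i 0; rewrite !scale0r.
  rewrite {1}[u]row_sum_delta (big_morph _ rD r0); apply: eq_bigr => b _.
  by rewrite replaceZ replace_delta.
rewrite deriveE// linear_sum; apply: eq_bigr => b _.
by rewrite linearZ deriveE.
Qed.

Lemma derive_blocks (G : profile R n -> R) x w : differentiable G x ->
  'D_w G x = \sum_j \sum_b
    submxrow w j 0 b * 'D_(delta_mx 0 (tagnat.Rank j b)) G x.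
Proof.
move=> dG; rewrite {1}[w]replace_sum deriveE// linear_sum.
by apply: eq_bigr => j _; rewrite -deriveE// derive_replace.
Qed.

Lemma derive_block_gradientE g x i (d : 'rV[R]_(n i)) : differentiable g x ->
  'D_(replace 0 d) g x = dot d (block_gradient i g x).
Proof.
move=> dg; rewrite derive_replace// block_gradientE; apply: eq_bigr => b _.
by rewrite !mxE.
Qed.

(** The pairing is a linear combination of coordinates of the full gradient; the derivative of each
    coordinate along [w] is then split over the blocks of [w]. *)
Lemma is_derive_dot_block_gradient g x i (d : 'rV[R]_(n i)) w :
  differentiable (gradient g) x ->
  is_derive x w (fun y => dot d (block_gradient i g y))
    (\sum_j dot d (submxrow w j *m (block_hessian i j g x)^T)).
Proof.
move=> dgrad; pose G a := fun y => gradient g y 0 (tagnat.Rank i a).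
have dG a : differentiable (G a) x.
  apply: (@differentiable_comp _ _ _ _ (gradient g)
    (fun v : profile R n => v 0 (tagnat.Rank i a))) => //.
  exact: differentiable_coord.
have -> : (fun y => dot d (block_gradient i g y)) =
    \sum_(a < n i) (d 0 a *: G a).
  apply/funext => y; rewrite fct_sumE; apply: eq_bigr => a _.
  by rewrite block_gradientE mxE.
have dZ a : is_derive x w (d 0 a *: G a) (d 0 a *: 'D_w (G a) x).
  by apply: is_deriveZ; apply: derivableP; exact: diff_derivable.
apply: is_derive_eq.
rewrite exchange_big /=; apply: eq_bigr => a _.
rewrite -mulr_sumr derive_blocks//; congr (_ * _); apply: eq_bigr => j _.
by rewrite mxE; apply: eq_bigr => b _; rewrite [_^T _ _]mxE block_hessianE.
Qed.

(** Pairing with a fixed [d] makes the block gradient along the segment a scalar function [phi], to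
    which the mean value theorem applies. *)
Lemma block_gradient_increment g i (d : 'rV[R]_(n i)) x y :
  (forall t : R, 0 <= t <= 1 -> differentiable (gradient g) (t *: (y - x) + x)) ->
  exists2 t : R, 0 <= t <= 1 &
    dot d (block_gradient i g y) - dot d (block_gradient i g x) =
    \sum_j dot d (submxrow (y - x) j *m
                  (block_hessian i j g (t *: (y - x) + x))^T).
Proof.
move=> dg; pose phi (t : R) := dot d (block_gradient i g (t *: (y - x) + x)).
pose dphi (t : R) := \sum_j dot d (submxrow (y - x) j *m
                  (block_hessian i j g (t *: (y - x) + x))^T).
have dphiP (t : R) : 0 <= t <= 1 -> is_derive t (1 : R) phi (dphi t).
  move=> t01; have := is_derive_dot_block_gradient g _ i d (y - x) (dg t t01).
  pose F z := dot d (block_gradient i g z).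
  have line (h : R) : phi (h *: 1 + t) = F (h *: (y - x) + (t *: (y - x) + x)).
    by rewrite /phi /F scalerDl addrA [h *: 1]mulr1.
  have [dd dE] := derivative_line _ _ _ _ _ _ _ _ _ line.
  by move=> [df De]; split; [exact/dd|rewrite dE].
have [|||c c01] := @MVT_segment R phi dphi 0 1.
- exact: ler01.
- by move=> t; rewrite in_itv /= => /andP[? ?]; apply: dphiP; rewrite !ltW.
- apply: derivable_within_continuous => t; rewrite in_itv /= => t01.
  exact: (@ex_derive _ _ _ _ _ _ _ (dphiP t t01)).
rewrite subr0 mulr1 /phi scale1r subrK scale0r add0r => E.
by exists c => //; move: c01; rewrite in_itv.
Qed.

End BlockDerivatives.

(** * Convexity and first-order conditions *)

Section Convexity.
Context {R : realType}.

Lemma near_open_line (V : normedModType R) (A : set V) (x v : V) :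
  open A -> A x -> \forall h \near 0^'+, A (h *: v + x).
Proof.
move=> oA Ax; have : h *: v + x @[h --> 0^'+] --> x.
  suff : h *: v + x @[h --> 0^'+] --> 0 *: v + x by rewrite scale0r add0r.
  apply: cvgD; last exact: cvg_cst.
  by apply: cvg_at_right_filter; exact: scalel_continuous.
by apply; exact: open_nbhs_nbhs.
Qed.

Lemma convex_set_line n (A : set 'rV[R]_n) u v (t : R) :
  convex_set (A : set (convex_lmodType 'rV[R]_n)) ->
  A u -> A v -> 0 <= t <= 1 -> A (t *: (v - u) + u).
Proof.
move=> cA Au Av /andP[t0 t1].
have /set_mem := cA v u (Itv01 t0 t1) (mem_set Av) (mem_set Au).
suff -> : conv (Itv01 t0 t1) (v : convex_lmodType 'rV[R]_n) u =
  t *: (v - u) + u by [].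
rewrite /conv /= scalerBr -addrA; congr (_ + _).
by rewrite scalerBl scale1r addrC.
Qed.

Lemma convex_function_line n (A : set 'rV[R]_n) (f : 'rV[R]_n -> R) u v (t : R) :
  convex_function (A : set (convex_lmodType 'rV[R]_n)) f ->
  A u -> A v -> 0 <= t <= 1 ->
  f (t *: (v - u) + u) - f u <= t * (f v - f u).
Proof.
move=> cf Au Av /andP[t0 t1].
have := cf (Itv01 t0 t1) v u (mem_set Av) (mem_set Au).
suff -> : conv (Itv01 t0 t1) (v : convex_lmodType 'rV[R]_n) u =
    t *: (v - u) + u.
  by rewrite convRE /= /unstable.onem; set a := f (_ + _); lra.
rewrite /conv /= scalerBr -addrA; congr (_ + _).
by rewrite scalerBl scale1r addrC.
Qed.

End Convexity.

(** * Functions convex in one block *)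

Section BlockConvexity.
Context {R : realType} {N : nat} {n : 'I_N -> nat}.
Implicit Types (x y w : profile R n) (i j : 'I_N) (g : profile R n -> R).

(** By convexity the increment at [u + h (v - u)] is at most [h] times the full increment; divide by
    [h] and let it tend to 0. *)
Lemma convex_block_gradient_le g y i (U : set 'rV[R]_(n i)) u v :
  convex_function (U : set (convex_lmodType 'rV[R]_(n i)))
    (fun u => g (replace y u)) ->
  U u -> U v -> differentiable g (replace y u) ->
  dot (v - u) (block_gradient i g (replace y u)) <=
  g (replace y v) - g (replace y u).
Proof.
move=> cg Uu Uv dg; rewrite -derive_block_gradientE//.
apply: derive_le_near; first exact: diff_derivable.
near=> h; rewrite -replaceDZ.
apply: (convex_function_line _ _ _ _ _ _ cg) => //.
by apply/andP; split; near: h; [exact: nbhs_right_ge|exact: nbhs_right_le].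
Unshelve. all: by end_near. Qed.

(** Adding the gradient inequalities between [u] and [u + h d], in both directions, shows that the
    gradient paired with [d] does not decrease along [d]. The derivative of this pairing is the
    Hessian form. *)
Lemma convex_block_hessian_ge0 g x i (U : set 'rV[R]_(n i)) W d :
  open U -> U (submxrow x i) ->
  convex_function (U : set (convex_lmodType 'rV[R]_(n i)))
    (fun u => g (replace x u)) ->
  open W -> W x -> twice_differentiable_on W g ->
  0 <= dot d (d *m (block_hessian i i g x)^T).
Proof.
move=> oU Ux cg oW Wx dg; have [dgx dgradx] := dg x Wx.
have dF := is_derive_dot_block_gradient g x i d (replace 0 d) dgradx.
(* The direction [replace 0 d] vanishes outside block [i], so only the diagonal Hessian block
   survives. *)
have <- : 'D_(replace 0 d) (fun y => dot d (block_gradient i g y)) x =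
    dot d (d *m (block_hessian i i g x)^T).
  rewrite (@derive_val _ _ _ _ _ _ _ dF) (bigD1 i)//= submxrow_replace.
  rewrite big1 ?addr0// => j ji.
  by rewrite submxrow_replace_neq// submxrow0 mul0mx -(scale0r 0) dotZr mul0r.
apply: (derive_ge_near _ _ _ _ _ 0); first exact: ex_derive.
near=> h; rewrite !mulr0 subr0 subr_ge0.
have h0 : 0 < h by [].
have Uv : U (h *: d + submxrow x i) by near: h; exact: near_open_line.
have Wv : W (h *: replace 0 d + x) by near: h; exact: near_open_line.
pose u := submxrow x i; pose v := h *: d + u.
have xE : replace x u = x by exact: replace_self.
have vE : replace x v = h *: replace 0 d + x by rewrite replaceDZ xE.
have vuE : v - u = h *: d by rewrite /v addrK.
have := convex_block_gradient_le _ _ _ _ u v cg Ux Uv.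
have := convex_block_gradient_le _ _ _ _ v u cg Uv Ux.
have -> : u - v = - (h *: d) by rewrite -vuE opprB.
rewrite vuE xE vE dotNl !dotZl => /(_ (dg _ Wv).1) H1 /(_ dgx) H2.
by rewrite -(ler_pM2l h0); lra.
Unshelve. all: by end_near. Qed.

Lemma prox_argmin_variational g y i (A : set 'rV[R]_(n i)) mu c u
    (w : 'rV[R]_(n i)) :
  convex_set (A : set (convex_lmodType 'rV[R]_(n i))) ->
  differentiable g (replace y u) ->
  argmin_set A (fun u => g (replace y u) + mu / 2 * enorm (u - c) ^+ 2) u ->
  A w ->
  0 <= dot (w - u) (block_gradient i g (replace y u)) + mu * dot (w - u) (u - c).
Proof.
move=> cA dg [Au umin] Aw; rewrite -derive_block_gradientE// addrC -lerBlDl sub0r.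
(* Compare [u] with [u + h (w - u)], which stays in [A]. The increment of the proximal term has a
   part linear in [h] and the part [h^2 mu/2 |w - u|^2], whose coefficient is the constant given
   here. *)
apply: (derive_ge_near _ _ _ _ _ (mu / 2 * enorm (w - u) ^+ 2)).
  exact: diff_derivable.
near=> h; rewrite -replaceDZ.
have h01 : 0 <= h <= 1.
  by apply/andP; split; near: h; [exact: nbhs_right_ge|exact: nbhs_right_le].
have := umin _ (convex_set_line _ _ _ _ _ cA Au Aw h01).
rewrite -[h *: _ + u - c]addrA.
move: (u - c) (w - u) (g _) (g _) => e v gu gv.
rewrite !sqr_enorm !(dotDl, dotDr, dotZl, dotZr) [dot e v]dotC.
by move: (dot e e) (dot v e) (dot v v) => ee ve vv; lra.
Unshelve. all: by end_near. Qed.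

End BlockConvexity.

(** * Lipschitz bound for the proximal best response *)

Lemma profiles_replace {R : realType} {N : nat} {n : 'I_N -> nat}
    (X : forall i, set 'rV[R]_(n i)) y i u :
  profiles X y -> X i u -> profiles X (replace y u).
Proof.
move=> Xy Xu j; have [->|ji] := eqVneq j i; first by rewrite submxrow_replace.
by rewrite submxrow_replace_neq//; exact: Xy.
Qed.

Lemma profiles_line {R : realType} {N : nat} {n : 'I_N -> nat}
    (X : forall i, set 'rV[R]_(n i)) (x y : profile R n) (t : R) :
  (forall i, convex_set (X i : set (convex_lmodType 'rV[R]_(n i)))) ->
  profiles X x -> profiles X y -> 0 <= t <= 1 ->
  profiles X (t *: (y - x) + x).
Proof.
move=> cX Xx Xy t01 i; rewrite submxrowD submxrowZ submxrowB.
by apply: convex_set_line => //; exact: cX.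
Qed.

(** Arithmetic core of the Lipschitz bound. The sum of [H1] and [H2] reads
    [q + S' <= mu (du - dv) = mu (g - r^2)]; then bound [q] and [S'] below and [g] above. In the
    application [r = |e|], [s = |z_i - y_i|], and [q], [S'] are the own-block and cross-block
    Hessian terms. *)
Lemma monotone_step {R : realFieldType} {mu ga gb q du dv g r s zt S S' : R} :
  0 < mu -> 0 <= ga + mu * du -> 0 <= - gb + mu * - dv -> gb - ga = q + S' ->
  zt * r ^+ 2 <= q -> - S * r <= S' -> g <= r * s -> du - dv = g - r ^+ 2 ->
  r * (r * (mu + zt)) <= r * (mu * s + S).
Proof.
move=> mu0 H1 H2 E1 Hq HS Hg E2; have := ler_wpM2l (ltW mu0) Hg.
have : mu * (du - dv) = mu * (g - r ^+ 2) by rewrite E2.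
by lra.
Qed.

Section BestResponse.
Context {d : measure_display} {T : measurableType d} {R : realType}.
Context {P : probability T R} {N : nat} {n : 'I_N -> nat}.
Context {X : forall i : 'I_N, set 'rV[R]_(n i)} {m : nat} {xi : T -> 'rV[R]_m}.
Context {psi : 'I_N -> profile R n -> 'rV[R]_m -> R}.
Context (regX : forall i, regular_game P X xi psi i).
Local Notation f := (cost P xi psi).

Lemma cost_differentiable i y : profiles X y ->
  differentiable (f i) y /\ differentiable (gradient (f i)) y.
Proof.
by move=> Xy; have [W [_ XW _ dW]] := cost_twice_differentiable (regX i);
  apply: dW; exact: XW.
Qed.

Lemma cost_hessian_ge0 i y v : profiles X y ->
  0 <= quad (block_hessian i i (f i) y) v.
Proof.
move=> Xy; have [W [oW XW _ dW]] := cost_twice_differentiable (regX i).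
have [U [oU XU _ _ [cU _]]] := cost_convex_C2 (regX i) (fun j _ => Xy j).
rewrite /quad dot_mulmx dotC.
by apply: (convex_block_hessian_ge0 _ _ _ U W) => //; [apply: XU|apply: XW].
Qed.

Lemma profiles_nonempty : profiles X !=set0.
Proof.
exists (\mxrow_i get (X i)) => i; rewrite mxrowK; apply: getPex.
exact: strategies_nonempty (regX i).
Qed.

Hypothesis n_gt0 : forall i, (0 < n i)%N.

(** Convexity of each cost in the player's own block makes the diagonal Hessian blocks positive
    semidefinite. Hence the denominators [mu + zeta_min] of [Gamma] are positive. *)
Lemma zeta_min_ge0 i : 0 <= zeta_min X f i.
Proof.
apply: lb_le_inf; first by have [x Xx] := profiles_nonempty; eexists; exists x.
move=> _ [x Xx <-]; apply: lambda_min_ge0 => // v; exact: cost_hessian_ge0.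
Qed.

Lemma zeta_minP i y v : profiles X y ->
  zeta_min X f i * enorm v ^+ 2 <= dot v (v *m (block_hessian i i (f i) y)^T).
Proof.
move=> Xy; rewrite dot_mulmx trmxK dotC.
apply: (le_trans _ (lambda_minP (n_gt0 i) _ _)).
apply: ler_wpM2r; first exact: sqr_ge0.
apply: ge_inf; last by exists y.
exists 0 => _ [x Xx <-]; apply: lambda_min_ge0 => // u; exact: cost_hessian_ge0.
Qed.

Context {mu : R} (mu_gt0 : 0 < mu) (contrX : contractive_game X f mu).
Local Notation xhat := (prox_best_response X f mu).

Lemma ler_zeta_max i j y : j != i -> profiles X y ->
  opnorm (block_hessian i j (f i) y) <= zeta_max X f i j.
Proof. by move=> ji Xy; apply: ub_le_sup; [exact: contrX.1|exists y]. Qed.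

(** Since [get] returns a member of any nonempty set, it is enough that the continuous proximal
    objective attains its minimum on the compact [X i]. *)
Lemma prox_best_response_argmin i y : profiles X y ->
  argmin_set (X i)
    (fun u => f i (replace y u) + mu / 2 * enorm (u - submxrow y i) ^+ 2)
    (xhat i y).
Proof.
move=> Xy; apply: getPex.
set h := fun u => f i (replace y u) + mu / 2 * enorm (u - submxrow y i) ^+ 2.
have [U [oU XU _ _ [_ [dU _]]]] := cost_convex_C2 (regX i) (fun j _ => Xy j).
have ch u : U u -> {for u, continuous h}.
  move=> /dU[/differentiable_continuous cu _].
  have ce := continuous_sqr_enormB (submxrow y i) u.
  exact: (cvgD cu (cvgM (cvg_cst (mu / 2)) ce)).
have [|u uX umin] := compact_EVT_min (strategies_nonempty (regX i))
    (strategies_compact (regX i)) _ (f := h).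
  apply: continuous_in_subspaceT => u /set_mem Xu; exact/ch/XU.
by exists u; split=> [|v Xv]; [exact: set_mem|apply: umin; exact: mem_set].
Qed.

Lemma prox_best_response_in i y : profiles X y -> X i (xhat i y).
Proof. by move=> /(prox_best_response_argmin i)[]. Qed.

Lemma prox_best_response_variational i y w : profiles X y -> X i w ->
  0 <= dot (w - xhat i y) (block_gradient i (f i) (replace y (xhat i y))) +
       mu * dot (w - xhat i y) (xhat i y - submxrow y i).
Proof.
move=> Xy Xw; apply: (prox_argmin_variational _ _ _ (X i)) => //.
- exact: strategies_convex (regX i).
- by apply: (cost_differentiable _ _ _).1; apply: profiles_replace => //;
    exact: prox_best_response_in.
- exact: prox_best_response_argmin.
Qed.

(** Each best response is tested in the variational inequality of the other. The gradient difference
    is bounded below through the Hessian blocks at one intermediate profile [c], with [zeta_min] for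
    the own block and [zeta_max] for the others. *)
Lemma prox_best_response_lipschitz i y z : profiles X y -> profiles X z ->
  enorm (xhat i z - xhat i y) <=
  \sum_j Gamma X f mu i j * enorm (submxrow z j - submxrow y j).
Proof.
move=> Xy Xz; set u := xhat i y; set v := xhat i z.
have Xu : X i u := prox_best_response_in i y Xy.
have Xv : X i v := prox_best_response_in i z Xz.
have VIu := prox_best_response_variational i y v Xy Xv.
have VIv := prox_best_response_variational i z u Xz Xu.
rewrite -/u -/v in VIu VIv.
set a := replace y u in VIu; set b := replace z v in VIv.
have Xa : profiles X a by exact: profiles_replace.
have Xb : profiles X b by exact: profiles_replace.
have cX j := strategies_convex (regX j).
set e := v - u in VIu *.
have [t t01 E] := block_gradient_increment (f i) i e a b
  (fun t t01 => (cost_differentiable i _ (profiles_line _ _ _ _ cX Xa Xb t01)).2).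
have := profiles_line _ _ _ _ cX Xa Xb t01.
move: E; set c := t *: (b - a) + a => E Xc.
(* The endpoints differ by [z - y] in the opponents' blocks and by [e], the quantity to be
   estimated, in block [i]. *)
have baj j : j != i -> submxrow (b - a) j = submxrow z j - submxrow y j.
  by move=> ji; rewrite submxrowB !submxrow_replace_neq.
have bai : submxrow (b - a) i = e by rewrite submxrowB !submxrow_replace.
rewrite (bigD1 i)//= bai in E.
have Zi := zeta_minP i c e Xc.
have Zj : - (\sum_(j | j != i) zeta_max X f i j *
      enorm (submxrow z j - submxrow y j)) * enorm e <=
    \sum_(j < N | j != i)
      dot e (submxrow (b - a) j *m (block_hessian i j (f i) c)^T).
  rewrite mulNr mulr_suml -sumrN; apply: ler_sum => j ji.
  rewrite lerNl -dotNr (le_trans (cauchy_schwarz _ _))// mulrC enormN.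
  apply: ler_wpM2r; first exact: enorm_ge0.
  rewrite (le_trans (ler_opnorm _ _))// baj//.
  by apply: ler_wpM2r; [exact: enorm_ge0|exact: ler_zeta_max].
have CS := cauchy_schwarz e (submxrow z i - submxrow y i).
have uvE : u - v = - e by rewrite opprB.
rewrite uvE !dotNl in VIv.
have Emu : dot e (u - submxrow y i) - dot e (v - submxrow z i) =
    dot e (submxrow z i - submxrow y i) - enorm e ^+ 2.
  by rewrite sqr_enorm -!dotNr -!dotDr; congr dot; rewrite /e;
    apply/rowP => k; rewrite !mxE; ring.
have zeta0 := zeta_min_ge0 i.
have D0 : 0 < mu + zeta_min X f i by rewrite ltr_wpDr.
have -> : \sum_j Gamma X f mu i j * enorm (submxrow z j - submxrow y j) =
    (mu * enorm (submxrow z i - submxrow y i) +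
     \sum_(j | j != i) zeta_max X f i j * enorm (submxrow z j - submxrow y j)) /
    (mu + zeta_min X f i).
  rewrite (bigD1 i)//= mxE eqxx mulrAC mulrDl mulr_suml; congr (_ + _).
  by apply: eq_bigr => j ji; rewrite mxE eq_sym (negbTE ji) mulrAC.
rewrite ler_pdivlMr//.
(* The final inequality carries a factor [|e|] on both sides. If it is zero, the claim is
   nonnegativity of the right-hand side. *)
have [/eqP e0|e0] := boolP (enorm e == 0).
  rewrite e0 mul0r addr_ge0//; first by rewrite mulr_ge0 ?enorm_ge0// ltW.
  apply: sumr_ge0 => j _; rewrite mulr_ge0 ?enorm_ge0//.
  by apply: sup_ge0 => _ [x _ <-]; exact: opnorm_ge0.
have e_gt0 : 0 < enorm e by rewrite lt0r e0 enorm_ge0.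
rewrite -(ler_pM2l e_gt0).
exact: (monotone_step mu_gt0 VIu VIv E Zi Zj CS Emu).
Qed.

(** The proximal term vanishes at the equilibrium strategy, which also minimizes the cost itself.
    Comparing the two minimizers forces the proximal term at the best response to be at most 0. *)
Lemma prox_best_response_nash i xstar : nash_equilibrium X f xstar ->
  xhat i xstar = submxrow xstar i.
Proof.
move=> [Xs ne]; have [Xu umin] := prox_best_response_argmin i xstar Xs.
have := umin _ (Xs i); have := (ne i).2 _ Xu.
rewrite subrr enorm0 expr0n /= mulr0 addr0 => H1 H2.
have : mu / 2 * enorm (xhat i xstar - submxrow xstar i) ^+ 2 <= 0 by lra.
rewrite pmulr_rle0 ?divr_gt0// => H.
apply/eqP; rewrite -subr_eq0; apply/eqP/enorm_eq0/eqP; rewrite -sqrf_eq0.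
by rewrite eq_le H sqr_ge0.
Qed.

End BestResponse.

(** * Real-valued expectations *)

Lemma contraction_cvg0 {R : realType} (q : R) (u e : nat -> R) :
  0 <= q < 1 -> (forall k, 0 <= u k) -> (forall k, u k.+1 <= q * u k + e k) ->
  e k @[k --> \oo] --> 0 -> u k @[k --> \oo] --> 0.
Proof.
move=> /andP[q0 q1] u0 uS e0; apply/cvgrPdist_lt => eps eps0.
have q1' : 0 < 1 - q by rewrite subr_gt0.
(* With this choice [eps / 2] is the fixed point of [t -> q t + del], so the accumulated
   perturbation never exceeds [eps / 2]. *)
pose del := eps / 2 * (1 - q).
have del0 : 0 < del by rewrite mulr_gt0 ?divr_gt0.
have /cvgrPdist_lt/(_ del del0)[K _ eK] := e0.
have ebound k : (K <= k)%N -> e k <= del.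
  by move=> /eK /=; rewrite sub0r normrN => /ltW; exact: le_trans (ler_norm _).
have iter m : u (K + m)%N <= q ^+ m * u K + eps / 2.
  elim: m => [|m IH]; first by rewrite addn0 mul1r lerDl divr_ge0 ?ltW.
  rewrite addnS (le_trans (uS _))// exprS.
  have := ebound _ (leq_addr m K); have := ler_wpM2l q0 IH.
  by rewrite /del; lra.
have qK : q ^+ m * u K @[m --> \oo] --> 0.
  rewrite -(mul0r (u K)); apply: cvgMl.
  by apply: cvg_expr; rewrite ger0_norm.
have /cvgrPdist_lt/(_ (eps / 2))[|M _ qM] := qK; first by rewrite divr_gt0.
exists (K + M)%N => // k /= KMk; rewrite sub0r normrN ger0_norm//.
have Kk : (K <= k)%N by rewrite (leq_trans _ KMk) ?leq_addr.
rewrite -(subnKC Kk) (le_lt_trans (iter _))//.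
have /qM : (M <= k - K)%N by rewrite leq_subRL.
rewrite /= sub0r normrN => /(le_lt_trans (ler_norm _)); lra.
Qed.

Section RealExpectation.
Context {d : measure_display} {T : measurableType d} {R : realType}.
Context {P : probability T R}.
Implicit Types Z : T -> R.

Lemma bounded_real_integrable Z (C : R) :
  measurable_fun [set: T] Z -> (forall w, `|Z w| <= C) -> real_integrable P Z.
Proof.
move=> mZ ZC; apply: measurable_bounded_integrable => //.
  exact: (le_lt_trans (probability_le1 P measurableT) (ltry 1)).
exists C; split; first exact: num_real.
by move=> M CM w _; exact: le_trans (ZC w) (ltW CM).
Qed.

Lemma expectation_Rintegral Z : real_integrable P Z ->
  ('E_P[Z])%E = (\int[P]_w Z w)%:E.
Proof. by move=> iZ; rewrite unlock fineK// integrable_fin_num. Qed.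

Lemma real_integrableD Z1 Z2 : real_integrable P Z1 -> real_integrable P Z2 ->
  real_integrable P (fun w => Z1 w + Z2 w).
Proof. by move=> i1 i2; exact: (integrableD measurableT i1 i2). Qed.

Lemma real_integrableZ (a : R) Z : real_integrable P Z ->
  real_integrable P (fun w => a * Z w).
Proof. by move=> iZ; exact: (integrableZl measurableT a iZ). Qed.

Lemma real_integrable_cst (a : R) : real_integrable P (fun _ => a).
Proof.
by apply: (bounded_real_integrable _ `|a|) => //; exact: measurable_cst.
Qed.

Lemma real_integrable_sum I (s : seq I) (Z : I -> T -> R) :
  (forall i, real_integrable P (Z i)) ->
  real_integrable P (fun w => \sum_(i <- s) Z i w).
Proof.
move=> iZ; elim: s => [|i s IH].
  by under eq_fun do rewrite big_nil; exact: real_integrable_cst.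
by under eq_fun do rewrite big_cons; exact: real_integrableD.
Qed.

Lemma Rintegral_sum I (s : seq I) (Z : I -> T -> R) :
  (forall i, real_integrable P (Z i)) ->
  \int[P]_w (\sum_(i <- s) Z i w) = \sum_(i <- s) \int[P]_w Z i w.
Proof.
move=> iZ; elim: s => [|i s IH].
  under eq_fun do rewrite big_nil.
  by rewrite big_nil Rintegral_cst// mul0r.
under eq_fun do rewrite big_cons.
by rewrite big_cons -IH RintegralD//; [exact: iZ|exact: real_integrable_sum].
Qed.

Lemma Rintegral_prob_cst (a : R) : \int[P]_(w in [set: T]) a = a.
Proof.
by rewrite Rintegral_cst//; have /= -> := probability_setT P; rewrite mulr1.
Qed.

(** Replacing [Z] by [min Z a] leaves the integral unchanged and makes the bound hold everywhere, as
    the pointwise comparison [le_Rintegral] requires. Domination by [|Z| + |a|] gives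
    integrability. *)
Lemma ae_le_Rintegral_cst Z (a : R) : real_integrable P Z ->
  {ae P, forall w, Z w <= a} -> \int[P]_w Z w <= a.
Proof.
move=> iZ Za; have mZ : measurable_fun [set: T] Z.
  by apply/measurable_EFinP; exact: measurable_int iZ.
have iM : real_integrable P (fun w => Num.min (Z w) a).
  apply: (le_integrable measurableT _ _ (real_integrableD _ _
    (integrable_abse iZ) (real_integrable_cst `|a|))).
    by apply/measurable_EFinP; exact: measurable_minr.
  move=> w _; rewrite lee_fin [leRHS]ger0_norm ?addr_ge0//.
  by case: (leP (Z w) a) => _; [rewrite lerDl|rewrite lerDr].
have -> : \int[P]_w Z w = \int[P]_w Num.min (Z w) a.
  congr fine; apply: ae_eq_integral => //.
  - by apply/measurable_EFinP.
  - exact: measurable_int iM.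
  - by apply: filterS Za => w Zwa _; rewrite min_l.
rewrite -[leRHS]Rintegral_prob_cst; apply: le_Rintegral => //.
- exact: real_integrable_cst.
- by move=> w _; rewrite ge_min lexx orbT.
Qed.

(** Let [e] be the mean of [Z]. Integrating [2 e Z <= Z^2 + e^2] gives [e^2 <= E[Z^2]], the case of
    Jensen's inequality that turns the conditional second-moment bound into a first-moment bound. *)
Lemma Rintegral_le_sqr Z (a : R) : 0 <= a -> real_integrable P Z ->
  real_integrable P (fun w => Z w ^+ 2) -> \int[P]_w (Z w ^+ 2) <= a ^+ 2 ->
  \int[P]_w Z w <= a.
Proof.
move=> a0 iZ iZ2 Z2a; set e := \int[P]_w Z w.
have [e0|/ltW e0] := leP 0 e; last exact: le_trans a0.
rewrite -(@ler_pXn2r _ 2)// ?nnegrE//; apply: le_trans Z2a.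
have : \int[P]_w (2 * e * Z w) <= \int[P]_w (Z w ^+ 2 + e ^+ 2).
  apply: le_Rintegral => //.
  - exact: real_integrableZ.
  - by apply: real_integrableD => //; exact: real_integrable_cst.
  - by move=> w _; have := sqr_ge0 (Z w - e); rewrite sqrrB; lra.
rewrite RintegralZl// RintegralD//; last exact: real_integrable_cst.
by rewrite Rintegral_prob_cst -/e; lra.
Qed.

End RealExpectation.

(** * Convergence of the scheme *)

Lemma measurable_enorm {d : measure_display} {T : measurableType d}
    {R : realType} {k : nat} (z : T -> 'rV[R]_k) :
  random_vector z -> measurable_fun [set: T] (fun w => enorm (z w)).
Proof.
move=> mz; have ms := continuous_measurable_fun (@sqrt_continuous R).
apply: (measurableT_comp ms); apply: measurable_sum => j.
by apply: measurable_funX; exact: mz.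
Qed.

Lemma random_vectorB {d : measure_display} {T : measurableType d}
    {R : realType} {k : nat} (z : T -> 'rV[R]_k) c :
  random_vector z -> random_vector (fun w => z w - c).
Proof.
move=> mz j; under eq_fun do rewrite !mxE.
by apply: measurable_funB => //; exact: mz.
Qed.

Lemma compact_diameter {R : realType} {k : nat} (A : set 'rV[R]_k) :
  compact A -> exists C, forall u v, A u -> A v -> enorm (u - v) <= C.
Proof.
move=> cA; have [->|/set0P A0] := eqVneq A set0; first by exists 0.
have [c _ cmax] := compact_EVT_max A0 cA (continuous_subspaceT enorm_continuous).
exists (enorm c + enorm c) => u v Au Av; apply: (le_trans (enormD _ _)).
by rewrite enormN lerD// cmax// mem_set.
Qed.

(** The sum runs over coordinates, each bounded by the norm of its block, so block [i] is counted
    [n i] times; this is harmless for convergence to 0. *)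
Lemma ler_enorm_blocks {R : realType} {N : nat} {n : 'I_N -> nat}
    (v : profile R n) :
  enorm v <= \sum_(s < \sum_i n i) enorm (submxrow v (tagnat.sig1 s)).
Proof.
apply: (le_trans (ler_enorm_sum _)); apply: ler_sum => s _.
have := ler_coord_enorm (submxrow v (tagnat.sig1 s)) (tagnat.sig2 s).
by rewrite mxE tagnat.sig2K.
Qed.

(** * Control of the variance by the mean distances *)

Section Convergence.
Context {d : measure_display} {T : measurableType d} {R : realType}.
Context {P : probability T R} {N : nat} {n : 'I_N -> nat}.
Context {X : forall i : 'I_N, set 'rV[R]_(n i)}.
Context {x : nat -> T -> profile R n} {xstar : profile R n}.
Hypothesis compactX : forall i, compact (X i).
Hypothesis rv_x : forall k, random_vector (x k).
Hypothesis Xx : forall k w, profiles X (x k w).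
Hypothesis Xstar : profiles X xstar.

Let dist k i w := enorm (submxrow (x k w) i - submxrow xstar i).

Lemma dist_integrable k i : real_integrable P (dist k i).
Proof.
have [C XC] := compact_diameter _ (compactX i).
apply: (bounded_real_integrable _ C) => [|w].
  apply: measurable_enorm; apply: random_vectorB => j.
  by under eq_fun do rewrite mxE; exact: rv_x.
rewrite ger0_norm ?enorm_ge0//; apply: XC; [exact: Xx|exact: Xstar].
Qed.

Lemma Rintegral_dist_ge0 k i : 0 <= \int[P]_w dist k i w.
Proof. by apply: Rintegral_ge0 => w _; exact: enorm_ge0. Qed.

Let total_dist k := \sum_(s < \sum_i n i) \int[P]_w dist k (tagnat.sig1 s) w.

(** Write [S] for the sum of distances and [M] for its mean. Centering at [xstar] bounds the squared
    deviation by [(M + S)^2 <= 2 M^2 + 2 S^2], and boundedness of the strategy sets gives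
    [S^2 <= C' S], so first moments suffice. *)
Lemma variance_le : exists C, forall k,
  (0 <= total_variance P (x k) <=
   (2 * total_dist k ^+ 2 + C * total_dist k)%:E)%E.
Proof.
have [C XC] := choice (fun i => compact_diameter _ (compactX i)).
pose C' := \sum_(s < \sum_i n i) C (tagnat.sig1 s).
have distC k i w : dist k i w <= C i by apply: XC; [exact: Xx|exact: Xstar].
exists (2 * C') => k; set M := total_dist k.
pose S w := \sum_(s < \sum_i n i) dist k (tagnat.sig1 s) w.
have xS w : enorm (x k w - xstar) <= S w.
  apply: (le_trans (ler_enorm_blocks _)); apply: ler_sum => s _.
  by rewrite submxrowB.
have S0 w : 0 <= S w by apply: sumr_ge0 => s _; exact: enorm_ge0.
have SC w : S w <= C' by apply: ler_sum => s _; exact: distC.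
have M0 : 0 <= M by apply: sumr_ge0 => s _; exact: Rintegral_dist_ge0.
have iS : real_integrable P S.
  by apply: real_integrable_sum => s; exact: dist_integrable.
have ES : \int[P]_w S w = M.
  by rewrite Rintegral_sum// => s; exact: dist_integrable.
have xsS w s : `|x k w 0 s - xstar 0 s| <= dist k (tagnat.sig1 s) w.
  have := ler_coord_enorm (submxrow (x k w) (tagnat.sig1 s) -
    submxrow xstar (tagnat.sig1 s)) (tagnat.sig2 s).
  by rewrite !mxE tagnat.sig2K.
have ix s : real_integrable P (fun w => x k w 0 s).
  apply: (bounded_real_integrable _ (C (tagnat.sig1 s) + `|xstar 0 s|)).
    exact: rv_x.
  move=> w; rewrite -[x k w 0 s](subrK (xstar 0 s)).
  by rewrite (le_trans (ler_normD _ _))// lerD2r (le_trans (xsS _ _)).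
have ic s : real_integrable P (fun=> xstar 0 s) by exact: real_integrable_cst.
have ixc s : real_integrable P (fun w => x k w 0 s - xstar 0 s).
  exact: (integrableB measurableT (ix s) (ic s)).
(* Coordinatewise, the distance from the mean to [xstar] is at most the mean of the distance. *)
have meanS : enorm (mean P (x k) - xstar) <= M.
  apply: (le_trans (ler_enorm_sum _)); apply: ler_sum => s _.
  rewrite !mxE expectation_Rintegral//= -[xstar 0 s](@Rintegral_prob_cst _ _ _ P).
  rewrite -(RintegralB measurableT (ix s) (ic s)).
  apply: (le_trans (le_normr_Rintegral measurableT (ixc s))).
  apply: le_Rintegral => //.
  - exact: (integrable_abse (ixc s)).
  - exact: dist_integrable.
have var_le w : enorm (mean P (x k) - x k w) ^+ 2 <= 2 * M ^+ 2 + 2 * C' * S w.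
  have -> : mean P (x k) - x k w = (mean P (x k) - xstar) - (x k w - xstar).
    by rewrite opprB addrA subrK.
  have H : enorm (mean P (x k) - xstar - (x k w - xstar)) <= M + S w.
    by apply: (le_trans (enormD _ _)); rewrite enormN; exact: lerD meanS (xS w).
  have : enorm (mean P (x k) - xstar - (x k w - xstar)) ^+ 2 <= (M + S w) ^+ 2.
    by rewrite (@ler_pXn2r _ 2)// ?nnegrE ?enorm_ge0 ?addr_ge0.
  move/le_trans; apply; have := sqr_ge0 (M - S w).
  by have := ler_wpM2r (S0 w) (SC w); rewrite sqrrB sqrrD; lra.
have rhs_int : real_integrable P (fun w => 2 * M ^+ 2 + 2 * C' * S w).
  apply: real_integrableD; first exact: real_integrable_cst.
  exact: real_integrableZ.
apply/andP; split; first by apply: expectation_ge0 => w; exact: sqr_ge0.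
have <- : \int[P]_w (2 * M ^+ 2 + 2 * C' * S w) = 2 * M ^+ 2 + 2 * C' * M.
  rewrite RintegralD//; [|exact: real_integrable_cst|exact: real_integrableZ].
  by rewrite Rintegral_prob_cst RintegralZl// ES.
rewrite -expectation_Rintegral// /total_variance unlock.
apply: ge0_le_integral => //.
- by move=> w _; rewrite lee_fin sqr_ge0.
- apply/measurable_EFinP; apply: measurable_funX.
  under eq_fun do rewrite -enormN opprB.
  by apply: measurable_enorm; exact: random_vectorB.
- exact: measurable_int rhs_int.
- by move=> w _; rewrite lee_fin.
Qed.

Lemma dist_cvg_variance_cvg :
  (forall i, \int[P]_w dist k i w @[k --> \oo] --> (0 : R)) ->
  total_variance P (x k) @[k --> \oo] --> 0%E.
Proof.
move=> dist0; have [C varC] := variance_le.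
have M0 : total_dist k @[k --> \oo] --> (0 : R).
  rewrite (_ : 0 = \sum_(s < \sum_i n i) 0); last by rewrite big1.
  by apply: cvg_big => [|s _]; [exact: add_continuous|exact: dist0].
apply: (@squeeze_cvge _ _ _ _ (fun=> 0%E) _
  (fun k => (2 * total_dist k ^+ 2 + C * total_dist k)%:E)).
- by apply: nearW => k; exact: varC.
- exact: cvg_cst.
apply: cvg_EFin; first exact: nearW.
rewrite (_ : 0 = 2 * 0 ^+ 2 + C * 0); last by rewrite expr0n !mulr0 addr0.
apply: cvgD; apply: cvgMr => //.
by rewrite expr2; under eq_fun do rewrite expr2; exact: cvgM.
Qed.

End Convergence.

(** * The linear recursion for the mean distances *)

Section Recursion.
Context {d : measure_display} {T : measurableType d} {R : realType}.
Context {P : probability T R} {N : nat} {n : 'I_N -> nat}.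
Context {X : forall i : 'I_N, set 'rV[R]_(n i)} {m : nat} {xi : T -> 'rV[R]_m}.
Context {psi : 'I_N -> profile R n -> 'rV[R]_m -> R}.
Context {mu : R} {alpha : 'I_N -> nat -> R} {F : nat -> set (set T)}.
Context {x : nat -> T -> profile R n} {xstar : profile R n}.
Hypothesis n_gt0 : forall i, (0 < n i)%N.
Hypothesis regX : forall i, regular_game P X xi psi i.
Hypothesis mu_gt0 : 0 < mu.
Hypothesis contrX : contractive_game X (cost P xi psi) mu.
Hypothesis scheme : inexact_prox_scheme P X (cost P xi psi) mu alpha F x.
Hypothesis alpha_ge0 : forall i k, 0 <= alpha i k.
Hypothesis xstar_nash : nash_equilibrium X (cost P xi psi) xstar.
Local Notation xhat := (prox_best_response X (cost P xi psi) mu).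
Local Notation G := (Gamma X (cost P xi psi) mu).

Let compactX i : compact (X i) := strategies_compact (regX i).

Let dist k i w := enorm (submxrow (x k w) i - submxrow xstar i).

Let err k i w := enorm (submxrow (x k.+1 w) i - xhat i (x k w)).

Lemma scheme_random_vector k : random_vector (x k).
Proof.
move=> j _ B mB; rewrite setTI.
exact: ((scheme_sigma_algebra scheme k).2 _ (scheme_adapted scheme k j mB)).
Qed.

Lemma dist_step k i w :
  dist k.+1 i w <= err k i w + \sum_j G i j * dist k j w.
Proof.
have Xs := xstar_nash.1; have Xk := scheme_feasible scheme k w.
have -> : dist k.+1 i w = enorm ((submxrow (x k.+1 w) i - xhat i (x k w)) +
    (xhat i (x k w) - xhat i xstar)).
  by rewrite addrA subrK (prox_best_response_nash regX mu_gt0 _ _ xstar_nash).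
apply: (le_trans (enormD _ _)); rewrite lerD2l.
exact: (prox_best_response_lipschitz regX n_gt0 mu_gt0 contrX i _ _ Xs Xk).
Qed.

Lemma err_integrable k i : real_integrable P (err k i) /\
  \int[P]_w err k i w <= alpha i k.
Proof.
have [Y [[iE iY _ EY] Ya]] := scheme_update scheme k i.
(* Measurability of the error is recovered from that of its square, whose integrability is part of
   [is_cond_expectation]; this avoids proving that [xhat i] is measurable. *)
have mE : measurable_fun [set: T] (err k i).
  have mE2 : measurable_fun [set: T] (fun w => err k i w ^+ 2).
    by apply/measurable_EFinP; exact: measurable_int iE.
  have -> : err k i = Num.sqrt \o (fun w => err k i w ^+ 2).
    by apply/funext => w /=; rewrite sqrtr_sqr ger0_norm ?enorm_ge0.
  exact: (measurableT_comp (continuous_measurable_fun (@sqrt_continuous R)) mE2).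
have [C XC] := compact_diameter _ (compactX i).
have iE1 : real_integrable P (err k i).
  apply: (bounded_real_integrable _ C) => // w; rewrite ger0_norm ?enorm_ge0//.
  apply: XC; first exact: (scheme_feasible scheme k.+1 w i).
  exact: (prox_best_response_in regX i _ (scheme_feasible scheme k w)).
split=> //; apply: Rintegral_le_sqr => //.
(* The defining identity of the conditional expectation is used on the whole space, which lies in
   [F k] as the complement of the empty set. *)
suff -> : \int[P]_w (err k i w ^+ 2) = \int[P]_w Y w.
  exact: ae_le_Rintegral_cst.
congr fine; symmetry; apply: EY.
have [[F0 FC _] _] := scheme_sigma_algebra scheme k.
by rewrite -(setD0 [set: T]); exact: FC.
Qed.

Lemma mean_dist_step k i :
  \int[P]_w dist k.+1 i w <= alpha i k + \sum_j G i j * \int[P]_w dist k j w.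
Proof.
have Xs := xstar_nash.1; have [iE Ea] := err_integrable k i.
have iD k' j : real_integrable P (dist k' j).
  exact: (dist_integrable compactX scheme_random_vector
    (scheme_feasible scheme) Xs).
have iGD j : real_integrable P (fun w => G i j * dist k j w).
  exact: real_integrableZ.
have iS := real_integrable_sum _ (index_enum 'I_N) _ iGD.
apply: (@le_trans _ _ (\int[P]_w (err k i w + \sum_j G i j * dist k j w))).
  apply: le_Rintegral => //; first exact: iD.
    exact: real_integrableD.
  by move=> w _; exact: dist_step.
rewrite RintegralD// Rintegral_sum// lerD//.
by apply: ler_sum => j _; rewrite RintegralZl//; exact: iD.
Qed.

Lemma mean_dist_cvg0 i : (forall j, alpha j k @[k --> \oo] --> 0) ->
  \int[P]_w dist k i w @[k --> \oo] --> (0 : R).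
Proof.
move=> alpha0; pose a k := \row_j \int[P]_w dist k j w : 'rV[R]_N.
have a_ge0 k j : 0 <= a k 0 j.
  by rewrite mxE; apply: Rintegral_ge0 => w _; exact: enorm_ge0.
have alpha_sum : \sum_j alpha j k @[k --> \oo] --> (0 : R).
  suff : \sum_j alpha j k @[k --> \oo] --> \sum_(j < N) (0 : R).
    by rewrite [X in _ --> X]big1.
  by apply: cvg_big => [|j _]; [exact: add_continuous|exact: alpha0].
have a0 : enorm (a k) @[k --> \oo] --> (0 : R).
  apply: (contraction_cvg0 (opnorm G) _ (fun k => \sum_j alpha j k)).
  - by rewrite opnorm_ge0 contrX.2.
  - by move=> k; exact: enorm_ge0.
  (* Entrywise [a_(k+1) <= Gamma a_k + e]. As the entries of [a_(k+1)] are nonnegative, the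
     Euclidean norms compare as well, and the contraction factor is [opnorm G]. *)
  - move=> k; pose e := \row_j alpha j k : 'rV[R]_N.
    have ek : enorm e <= \sum_j alpha j k.
      apply: (le_trans (ler_enorm_sum _)); apply: ler_sum => j _.
      by rewrite mxE ger0_norm.
    apply: (le_trans _ (lerD (ler_opnorm G (a k)) ek)).
    apply: (le_trans _ (enormD _ _)); apply: ler_enorm => j.
    rewrite a_ge0 !mxE addrC; apply: (le_trans (mean_dist_step k j)).
    by rewrite lerD2l; apply: ler_sum => l _; rewrite !mxE mulrC.
  - exact: alpha_sum.
apply: (squeeze_cvgr _ (cvg_cst (0 : R)) a0); near=> k.
have := a_ge0 k i; have := ler_coord_enorm (a k) i.
by rewrite mxE => /(le_trans (ler_norm _)) -> ->.
Unshelve. all: by end_near. Qed.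

End Recursion.

Theorem proposition3 (R : realType) (d : measure_display)
    (T : measurableType d) (P : probability T R)
    (N : nat) (n : 'I_N -> nat) (X : forall i : 'I_N, set 'rV[R]_(n i))
    (m : nat) (xi : T -> 'rV[R]_m)
    (psi : 'I_N -> profile R n -> 'rV[R]_m -> R)
    (mu : R) (alpha : 'I_N -> nat -> R) (F : nat -> set (set T))
    (x : nat -> T -> profile R n) (xstar : profile R n)
    (N_gt0 : (0 < N)%N) (n_gt0 : forall i, (0 < n i)%N)
    (xi_rv : random_vector xi)
    (assumptionA : forall i, regular_game P X xi psi i)
    (mu_gt0 : 0 < mu)
    (assumptionB : contractive_game X (cost P xi psi) mu)
    (scheme : inexact_prox_scheme P X (cost P xi psi) mu alpha F x)
    (alpha_ge0 : forall i k, 0 <= alpha i k)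
    (alpha_cvg0 : forall i, alpha i k @[k --> \oo] --> 0)
    (xstar_nash : nash_equilibrium X (cost P xi psi) xstar) :
  (total_variance P (x k) @[k --> \oo] --> 0%E) /\
  (forall i : 'I_N,
     'E_P[fun w => (enorm (submxrow (x k w) i - submxrow xstar i))%R]%E
       @[k --> \oo] --> 0%E).
Proof.
have compactX i := strategies_compact (assumptionA i).
have rv_x := scheme_random_vector scheme.
have Xx := scheme_feasible scheme.
have Xstar := xstar_nash.1.
have dist0 i := mean_dist_cvg0 n_gt0 assumptionA mu_gt0 assumptionB scheme
  alpha_ge0 xstar_nash i alpha_cvg0.
split; first exact: (dist_cvg_variance_cvg compactX rv_x Xx Xstar dist0).
(* The distances are integrable, so the extended-real expectations are finite and reduce to the real
   integrals of [dist0]. *)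
move=> i; under eq_fun do
  rewrite (expectation_Rintegral _ (dist_integrable compactX rv_x Xx Xstar _ i)).
by apply: cvg_EFin; [exact: nearW|exact: dist0].
Qed.
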